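(* Fix $s\ge3$ and let $\mathcal{U}$ be a monster model of $T^2_s$. Let $p_E\in S_1(\mathcal{U})$ be the unique global $1$-type containing $\neg E(x,b)$ for all $b\in\mathcal{U}$. Then $p_E$ is finitely approximated but not generically stable.
   Context: $T^2_s$ is the theory, in the language $\{E\}$ of graphs, of the Fraïssé limit of the class of finite $K_s$-free graphs ($K_s$ the complete graph on $s$ vertices); by quantifier elimination $p_E$ is well-defined. A global type $p$, viewed as a $\{0,1\}$-valued measure, is finitely approximated if there is a small model $M$ such that for every $\mathcal{L}$-formula $\phi(x;y)$ and $\epsilon>0$ there are $a_1,\dots,a_n\in M^x$ with $|p(\phi(x;b))-\frac1n|\{i:\models\phi(a_i;b)\}||<\epsilon$ for all $b$. $p$ is generically stable if there is a small $M$ such that $p$ is $M$-invariant and for every Morley sequence $(a_i)_{i<\alpha}$ in $p$ over $M$ ($a_i\models p|_{M\cup\{a_j:j<i\}}$) and every infinite ordinal $\alpha$, the set of formulas $\phi$ with $\{i:\models\neg\phi(a_i)\}$ finite is a complete type. *)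

(* Defs.v *)
From mathcomp Require Import all_boot all_order all_algebra.
From mathcomp Require Import all_classical reals.

Set Implicit Arguments.
Unset Strict Implicit.
Unset Printing Implicit Defensive.

Import Order.TTheory GRing.Theory Num.Theory.

Local Open Scope classical_set_scope.
Local Open Scope ring_scope.

Record structure : Type := Structure {
  dom :> Type;
  edge : dom -> dom -> Prop }.

(* First-order formulas (with equality) whose free variables are named by the
   elements of V; [All] binds the variable [None] of its body.  Thus
   - [formula void] is the type of sentences;
   - [formula (option 'I_m)] is the type of L-formulas phi(x; y_1 .. y_m),
     the variable x being [None];
   - [formula (option U)] is the type of L(U)-formulas in the single variable x
     ([None]), the parameter b being written [Some b]. *)
Inductive formula (V : Type) : Type :=
| Eq of V & V
| Edge of V & V
| Bot
| Imp of formula V & formula V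
| All of formula (option V).

Arguments Bot {V}.

Definition Not (V : Type) (phi : formula V) : formula V := Imp phi Bot.

Fixpoint rename (V W : Type) (f : V -> W) (phi : formula V) {struct phi} : formula W :=
  match phi with
  | Eq x y => Eq (f x) (f y)
  | Edge x y => Edge (f x) (f y)
  | Bot => Bot
  | Imp phi1 phi2 => Imp (rename f phi1) (rename f phi2)
  | All phi1 => All (rename (omap f) phi1)
  end.

Fixpoint free_vars (V : Type) (phi : formula V) {struct phi} : set V :=
  match phi with
  | Eq x y => [set x; y]
  | Edge x y => [set x; y]
  | Bot => set0
  | Imp phi1 phi2 => free_vars phi1 `|` free_vars phi2
  | All phi1 => [set x | free_vars phi1 (Some x)]
  end.

(* [oapp v a] sends [None] to a and [Some x] to v x. *)
Fixpoint sat (G : structure) (V : Type) (v : V -> G) (phi : formula V) {struct phi}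
    : Prop :=
  match phi with
  | Eq x y => v x = v y
  | Edge x y => edge (v x) (v y)
  | Bot => False
  | Imp phi1 phi2 => sat v phi1 -> sat v phi2
  | All phi1 => forall a : G, sat (oapp v a) phi1
  end.

Definition models (G : structure) (T : set (formula void)) : Prop :=
  forall phi, T phi -> sat (of_void G) phi.

Definition is_embedding (A G : structure) (f : A -> G) : Prop :=
  injective f /\ forall x y, edge x y <-> edge (f x) (f y).

Definition embeds (A G : structure) : Prop :=
  exists f : A -> G, is_embedding f.

Definition is_automorphism (G : structure) (g : G -> G) : Prop :=
  bijective g /\ forall x y, edge x y <-> edge (g x) (g y).

Definition substructure (G : structure) (A : set G) : structure :=
  @Structure A (fun x y => edge (val x) (val y)).

Definition elementary (G : structure) (M : set G) : Prop :=
  forall n (phi : formula 'I_n) (v : 'I_n -> substructure M),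
    sat v phi <-> sat (fun i => val (v i) : G) phi.

Definition is_graph (G : structure) : Prop :=
  (forall x : G, ~ edge x x) /\ (forall x y : G, edge x y -> edge y x).

Definition complete_graph (s : nat) : structure :=
  @Structure 'I_s (fun i j => i <> j).

Definition finite_Ks_free_graph (s : nat) (A : structure) : Prop :=
  [/\ finite_set (@setT A), is_graph A & ~ embeds (complete_graph s) A].

Definition ultrahomogeneous (G : structure) : Prop :=
  forall (A : set G) (f : substructure A -> G),
    finite_set A -> is_embedding f ->
    exists g : G -> G, is_automorphism g /\ forall x, g (val x) = f x.

Definition fraisse_limit (C : structure -> Prop) (G : structure) : Prop :=
  [/\ countable (@setT G), ultrahomogeneous G &
      forall A : structure, finite_set (@setT A) -> (C A <-> embeds A G)].

(* The Fraisse limit is unique up to isomorphism, hence so is its theory. *)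
Definition T2 (s : nat) : set (formula void) :=
  [set phi | forall G : structure,
    fraisse_limit (finite_Ks_free_graph s) G -> sat (of_void G) phi].

Definition formulas_over (U : structure) (A : set U) :
    set (formula (option U)) :=
  [set phi : formula (option U) | forall b : U, free_vars phi (Some b) -> A b].

Definition holds (U : structure) (phi : formula (option U)) (a : U) : Prop :=
  sat (oapp id a) phi.

Definition inst (U : structure) m (phi : formula (option 'I_m))
    (b : 'I_m -> U) : formula (option U) := rename (omap b) phi.

Definition finitely_satisfiable (U : structure) (p : set (formula (option U)))
    : Prop :=
  forall F : set (formula (option U)), finite_set F -> F `<=` p ->
    exists a : U, forall phi, F phi -> holds phi a.

(* p is in S_1(A); consistency with the elementary diagram of U is expressed as
   finite satisfiability in U. *)
Definition complete_type (U : structure) (A : set U)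
    (p : set (formula (option U))) : Prop :=
  [/\ p `<=` formulas_over A,
      finitely_satisfiable p &
      forall phi, formulas_over A phi -> p phi \/ p (Not phi)].

Definition global_type (U : structure) (p : set (formula (option U))) : Prop :=
  complete_type setT p.

Definition realizes (U : structure) (a : U) (p : set (formula (option U)))
    : Prop :=
  forall phi, p phi -> holds phi a.

(* Cardinals are represented by types K; "small" means "of size < K". *)
Definition small (K : Type) (T : Type) (A : set T) : Prop :=
  ~ (@setT K #<= A)%card.

Definition saturated (K : Type) (U : structure) : Prop :=
  forall (A : set U) (p : set (formula (option U))),
    small K A -> complete_type A p -> exists a : U, realizes a p.

Definition partial_elementary (U : structure) (A : set U) (f : U -> U) : Prop :=
  forall n (phi : formula 'I_n) (v : 'I_n -> U), (forall i, A (v i)) ->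
    (sat v phi <-> sat (f \o v) phi).

Definition strongly_homogeneous (K : Type) (U : structure) : Prop :=
  forall (A : set U) (f : U -> U), small K A -> partial_elementary A f ->
    exists g : U -> U, is_automorphism g /\ forall x, A x -> g x = f x.

(* The language being countable, K is only required to be uncountable. *)
Definition monster_model (K : Type) (T : set (formula void)) (U : structure)
    : Prop :=
  [/\ ~ countable (@setT K), models U T, saturated K U &
      strongly_homogeneous K U].

Definition small_model (K : Type) (U : structure) (M : set U) : Prop :=
  small K M /\ elementary M.

Definition finitely_approximated (R : realType) (K : Type) (U : structure)
    (p : set (formula (option U))) : Prop :=
  exists M : set U, small_model K M /\
    forall m (phi : formula (option 'I_m)) (eps : R), 0 < eps ->
    exists (n : nat) (a : 'I_n -> U),
      [/\ (0 < n)%N, (forall i, M (a i)) &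
          forall b : 'I_m -> U,
            `| (nat_of_bool `[< p (inst phi b) >])%:R
               - (#|[pred i | `[< holds (inst phi b) (a i) >]]|)%:R / n%:R |
            < eps].

Definition invariant (U : structure) (M : set U) (p : set (formula (option U)))
    : Prop :=
  forall g : U -> U, is_automorphism g -> (forall x, M x -> g x = x) ->
    forall phi, p phi <-> p (rename (omap g) phi).

(* Ordinals are represented by well-ordered types. *)
Definition strict_well_order (I : Type) (lt : I -> I -> Prop) : Prop :=
  [/\ well_founded lt,
      (forall i j k, lt i j -> lt j k -> lt i k) &
      forall i j, [\/ lt i j, i = j | lt j i]].

Definition morley_sequence (U : structure) (M : set U)
    (p : set (formula (option U))) (I : Type) (lt : I -> I -> Prop)
    (a : I -> U) : Prop :=
  forall i, realizes (a i)
    (p `&` formulas_over (M `|` [set a j | j in [set j | lt j i]])).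

Definition average_type (U : structure) (I : Type) (a : I -> U) :
    set (formula (option U)) :=
  [set phi | finite_set [set i | ~ holds phi (a i)]].

Definition generically_stable (K : Type) (U : structure)
    (p : set (formula (option U))) : Prop :=
  exists M : set U, [/\ small_model K M, invariant M p &
    forall (I : Type) (lt : I -> I -> Prop) (a : I -> U),
      strict_well_order lt -> infinite_set (@setT I) ->
      morley_sequence M p lt a -> global_type (average_type a)].

Definition contains_all_nonedges (U : structure) (p : set (formula (option U)))
    : Prop :=
  forall b : U, p (Not (Edge None (Some b))).

(* Main.v *)
Require Import Defs.
From mathcomp Require Import all_boot all_order all_algebra.
From mathcomp Require Import all_classical reals.
From mathcomp Require Import zify.

(* Write s = t + 1.  The universe U is a K_(t+1)-free graph in which every
   K_t-free part of a finite set is cut out by some vertex; this gives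
   quantifier elimination, and p_E is the set of formulas true of a vertex that
   is distinct from, and not adjacent to, all their parameters.

   Finite approximation: for each e there is a finite K_(t+1)-free graph on n
   vertices whose K_t-free sets all have fewer than n/e vertices.  Embed it in a
   countable model as a_1, ..., a_n.  The neighbourhood of any b is K_t-free, so
   all but 2n/e of the a_i are generic over b.  The finite graph is built
   greedily, by repeatedly adding a t-clique on low-degree vertices at pairwise
   distance > 2 (which creates no K_(t+1)), chosen to lie inside a constant
   fraction of the large sets that are still K_t-free; after linearly many steps
   no such set is left.

   Failure of generic stability: a Morley sequence indexed by nat is an infinite
   independent set, so (as t >= 2) some b is adjacent to exactly its terms of
   even index, and E(x, b) is not decided by the average type. *)

Set Implicit Arguments.
Unset Strict Implicit.
Unset Printing Implicit Defensive.

(** * Finite graphs with sparse K_t-free sets *)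

Definition clique (G : structure) (k : nat) (f : 'I_k -> G) : Prop :=
  forall i j, i <> j -> edge (f i) (f j).

Definition rel_graph (V : Type) (E : rel V) : structure :=
  @Structure V (fun x y => E x y).

Lemma rel_clique_sub (V : Type) (E E' : rel V) k (f : 'I_k -> V) :
  (forall x y, E x y -> E' x y) ->
  @clique (rel_graph E) k f -> @clique (rel_graph E') k f.
Proof. by move=> EE' cf i j /cf; apply: EE'. Qed.

Section Greedy.
Variable V : finType.
Implicit Types (E : rel V) (S T : {set V}).

(** Double counting of the pairs of a point [x] of [A] and a member [S] of [F] containing [x]: if
    every point of [A] lay in less than a fraction 1/[q] of the members, the count would be too
    small for the sizes of the sets [S :&: A]. *)
Lemma popular_point (F : {set {set V}}) (A : {set V}) q :
    (0 < #|V|)%N -> (0 < #|F|)%N ->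
    (forall S, S \in F -> #|V| <= q * #|S :&: A|)%N ->
  exists2 x, x \in A & (#|F| <= q * #|[set S in F | x \in S]|)%N.
Proof.
move=> V0 F0 large; apply: contrapT => none.
have dbl : (\sum_(S in F) #|S :&: A| = \sum_(x in A) #|[set S in F | x \in S]|)%N.
  under eq_bigr do rewrite -sum1_card big_mkcond /=.
  rewrite exchange_big [RHS]big_mkcond /=; apply: eq_bigr => x _.
  case: ifP => xA; last by rewrite big1 // => S _; rewrite inE xA andbF.
  rewrite -sum1_card [RHS]big_mkcond [LHS]big_mkcond /=; apply: eq_bigr => S _.
  by rewrite !inE xA andbT; case: (S \in F).
have le1 : (#|V| * #|F| <= q * \sum_(S in F) #|S :&: A|)%N.
  rewrite mulnC -sum_nat_const big_distrr /=; exact: leq_sum.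
have [x0 x0A] : exists x, x \in A.
  have /card_gt0P[S SF] := F0; have := large S SF.
  case: (set_0Vmem (S :&: A)) => [->|[x]]; first by rewrite cards0; lia.
  by rewrite inE => /andP[_ xA]; exists x.
have le2 : (q * \sum_(S in F) #|S :&: A| < #|A| * #|F|)%N.
  rewrite dbl big_distrr /= -sum_nat_const.
  have lt x : x \in A -> (q * #|[set S in F | x \in S]| < #|F|)%N.
    by move=> xA; rewrite ltnNge; apply/negP => ?; apply: none; exists x.
  rewrite (bigD1 x0) //= [X in (_ < X)%N](bigD1 x0) //=.
  rewrite -addSn leq_add ?lt // leq_sum // => x /andP[xA _].
  exact/ltnW/lt.
have : (#|A| * #|F| <= #|V| * #|F|)%N by rewrite leq_mul2r max_card orbT.
lia.
Qed.

(** Distance at most 2 in the graph [E]. *)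
Definition near E : rel V :=
  fun x y => [|| x == y, E x y | [exists z, E x z && E z y]].

Lemma near_sym E : symmetric E -> symmetric (near E).
Proof.
move=> Es x y; rewrite /near eq_sym Es; congr [|| _, _ | _].
by apply: eq_existsb => z; rewrite andbC Es [E z _]Es.
Qed.

Lemma card_bigcup_le (I : finType) (A : {set I}) (F : I -> {set V}) b :
  (forall i, i \in A -> #|F i| <= b)%N -> (#|\bigcup_(i in A) F i| <= #|A| * b)%N.
Proof.
move=> Fb; rewrite -sum_nat_const.
elim/big_rec2: _ => [|i m S iA le]; first by rewrite cards0.
apply: leq_trans (leq_card_setU _ _) _; exact: leq_add (Fb i iA) le.
Qed.

Lemma card_near E d x : (forall y, #|[set z | E y z]| <= d)%N ->
  (#|[set y | near E x y]| <= 1 + d + d * d)%N.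
Proof.
move=> Ed; have sub : [set y | near E x y] \subset
    [set x] :|: [set z | E x z] :|: \bigcup_(z in [set z | E x z]) [set y | E z y].
  apply/fintype.subsetP => y; rewrite !inE /near eq_sym orbA => /orP[->//|/existsP[z /andP[xz zy]]].
  by apply/orP; right; apply/bigcupP; exists z; rewrite inE.
apply: leq_trans (subset_leq_card sub) _.
apply: leq_trans (leq_card_setU _ _) _; apply: leq_add.
  apply: leq_trans (leq_card_setU _ _) _; rewrite cards1; exact: leq_add.
apply: leq_trans (card_bigcup_le (b := d) _) _ => //.
by rewrite leq_mul2r Ed orbT.
Qed.

(* The points are chosen one by one, each time keeping a fraction 1/q of the
   members of F that contain the points chosen so far. *)
Lemma popular_far_points E (L : {set V}) (F : {set {set V}}) b q j :
    (0 < #|V|)%N -> (0 < #|F|)%N -> symmetric E ->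
    (forall x, #|[set y | near E x y]| <= b)%N ->
    (forall S, S \in F -> #|V| + q * (j * b) <= q * #|S :&: L|)%N ->
  exists xs : seq V, [/\ size xs = j, {subset xs <= L},
    pairwise (fun x y => ~~ near E x y) xs &
    (#|F| <= q ^ j * #|[set S in F | [set x in xs] \subset S]|)%N].
Proof.
move=> V0 F0 Es ballb; elim: j => [|j IH] large.
  exists [::]; split=> //; rewrite mul1n; apply: subset_leq_card.
  by apply/fintype.subsetP => S SF; rewrite inE SF; apply/fintype.subsetP => x; rewrite inE.
have [S SF|xs [sz xsL far popxs]] := IH; first by have := large S SF; lia.
pose F' := [set S in F | [set x in xs] \subset S].
have F'0 : (0 < #|F'|)%N by move: popxs; rewrite -/F'; case: #|F'| => //; lia.
pose N := \bigcup_(x in [set x in xs]) [set y | near E x y].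
have N_le : (#|N| <= j * b)%N.
  apply: leq_trans (card_bigcup_le (b := b) _) _ => //.
  by rewrite leq_mul2r cardsE -sz card_size orbT.
(* Removing the balls around the points chosen so far costs each [S] at most [j * b] points of [L],
   which the slack in [large] absorbs. *)
have [S|x /setDP[xL xN] popx] := @popular_point F' (L :\: N) q V0 F'0.
  rewrite inE => /andP[/large SL _].
  have : (#|S :&: L| <= #|S :&: (L :\: N)| + #|N|)%N.
    rewrite -(cardsID N (S :&: L)) addnC finset.setIDA leq_add2l.
    by apply: subset_leq_card; apply: finset.subsetIr.
  nia.
exists (x :: xs); split=> /=.
- by rewrite sz.
- by move=> y; rewrite inE => /orP[/eqP->|/xsL].
- rewrite far andbT; apply/allP => y yxs; rewrite near_sym //.
  apply: contra xN => xy; apply/bigcupP; exists y; by rewrite inE.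
- apply: leq_trans popxs _; rewrite expnSr -mulnA leq_mul2l; apply/orP; right.
  apply: leq_trans popx _; rewrite leq_mul2l; apply/orP; right.
  apply/subset_leq_card/fintype.subsetP => S; rewrite !inE => /andP[/andP[-> sS] xS] /=.
  apply/fintype.subsetP => y; rewrite !inE => /orP[/eqP->//|yxs].
  by apply: (fintype.subsetP sS); rewrite inE.
Qed.

Definition add_clique E (xs : seq V) : rel V :=
  fun x y => E x y || [&& x != y, x \in xs & y \in xs].

Lemma far_pairwise E xs x y : symmetric E ->
  pairwise (fun x y => ~~ near E x y) xs ->
  x \in xs -> y \in xs -> x != y -> ~~ near E x y.
Proof.
move=> Es; elim: xs => //= z xs IH /andP[/allP zfar /IH far].
rewrite !inE => /orP[/eqP->|xxs] /orP[/eqP->|yxs] //.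
- by rewrite eqxx.
- by move=> _; apply: zfar.
- by move=> _; rewrite near_sym //; apply: zfar.
- exact: far.
Qed.

Lemma far_uniq E xs : pairwise (fun x y => ~~ near E x y) xs -> uniq xs.
Proof.
move=> far; rewrite uniq_pairwise; apply: sub_pairwise far => x y.
by apply: contra => /eqP->; rewrite /near eqxx.
Qed.

(* A clique using a new edge xy lies inside xs: any further vertex outside xs
   would be a common neighbour of x and y. *)
Lemma add_clique_free E xs :
    symmetric E -> irreflexive E -> pairwise (fun x y => ~~ near E x y) xs ->
    (forall f, ~ @clique (rel_graph E) (size xs).+1 f) ->
  forall f, ~ @clique (rel_graph (add_clique E xs)) (size xs).+1 f.
Proof.
move=> Es Ei far free f cf.
have f_inj : injective f.
  move=> i j fij; apply: contrapT => /cf /=.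
  by rewrite fij /add_clique Ei eqxx.
have [[i [j [ij nE]]]|old] := pselect (exists i j, i <> j /\ ~~ E (f i) (f j)); last first.
  apply: (free f) => i j ij; apply: contrapT => /negP nE.
  by apply: old; exists i, j.
have := cf _ _ ij; rewrite /= /add_clique (negbTE nE) /= => /and3P[fij ixs jxs].
have all_xs k : f k \in xs.
  have [->//|/eqP ki] := eqVneq k i; have [->//|/eqP kj] := eqVneq k j.
  apply: contraT => kxs; have := cf _ _ ki; have := cf _ _ kj.
  rewrite /= /add_clique (negbTE kxs) !andbF !orbF => kj' ki'.
  have /negP[] := far_pairwise Es far ixs jxs fij.
  by apply/or3P/Or33; apply/existsP; exists (f k); rewrite Es ki' kj'.
have : (#|[set f i | i : 'I_(size xs).+1]| <= size xs)%N.
  apply: leq_trans (card_size xs); apply/subset_leq_card/fintype.subsetP.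
  by move=> _ /imsetP[k _ ->]; apply: all_xs.
by rewrite card_imset // card_ord ltnn.
Qed.

Definition thick t E S := `[< exists f, [/\ forall i, f i \in S & @clique (rel_graph E) t f] >].

(** The obstructions to be eliminated: the greedy construction has succeeded once this family is
    empty. *)
Definition bad_sets t e E := [set S : {set V} | (#|V| <= e * #|S|)%N && ~~ thick t E S].

(** New edges create no new bad set, and a set that includes [xs] stops being bad because [xs] has
    become a t-clique in it. *)
Lemma bad_sets_add t e E xs : uniq xs -> size xs = t ->
  bad_sets t e (add_clique E xs) \subset
  bad_sets t e E :\: [set S in bad_sets t e E | [set x in xs] \subset S].
Proof.
move=> uxs sz; apply/fintype.subsetP => S; rewrite !inE => /andP[-> /= nthick].
have nthickE : ~~ thick t E S.
  apply: contra nthick => /asboolP[f [fS cf]]; apply/asboolP; exists f; split=> //.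
  by apply: rel_clique_sub cf => x y; rewrite /add_clique => ->.
rewrite nthickE /= andbT; apply: contra nthick => sub; apply/asboolP.
exists (fun i : 'I_t => tnth (Tuple (introT eqP sz)) i); split=> [i|i j ij] /=.
  by apply: (fintype.subsetP sub); rewrite inE mem_tnth.
rewrite /add_clique; apply/orP; right; rewrite !mem_tnth !andbT.
by apply/negP => /eqP eq; apply: ij; apply: tuple_uniqP eq.
Qed.


Definition deg E x := #|[set y | E x y]|.

Lemma deg_add E xs x :
  (deg (add_clique E xs) x <= deg E x + (x \in xs) * size xs)%N.
Proof.
rewrite /deg; have sub : [set y | add_clique E xs x y] \subset
    [set y | E x y] :|: (if x \in xs then [set y in xs] else finset.set0).
  apply/fintype.subsetP => y; rewrite !inE /add_clique => /orP[->//|/and3P[_ -> yxs]].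
  by rewrite inE yxs orbT.
apply: leq_trans (subset_leq_card sub) _; apply: leq_trans (leq_card_setU _ _) _.
rewrite leq_add2l; case: (x \in xs); last by rewrite cards0.
by rewrite mul1n cardsE card_size.
Qed.

Lemma sum_deg_add E xs : uniq xs ->
  (\sum_x deg (add_clique E xs) x <= \sum_x deg E x + size xs * size xs)%N.
Proof.
move=> uxs; apply: (@leq_trans (\sum_x (deg E x + (x \in xs) * size xs))%N).
  by apply: leq_sum => x _; apply: deg_add.
rewrite big_split /= leq_add2l -big_distrl /= leq_mul2r; apply/orP; right.
by rewrite -big_mkcond /= sum1_card (card_uniqP uxs).
Qed.

Lemma card_full E D m : (\sum_x deg E x <= m)%N ->
  (#|[set x | D <= deg E x]| * D <= m)%N.
Proof.
apply: leq_trans; rewrite -sum_nat_const big_mkcond /=; apply: leq_sum => x _.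
by rewrite inE; case: (leqP D (deg E x)).
Qed.

(** The step counter is [k]: each step adds at most t^2 to the degree sum and keeps at most a
    fraction 1 - 1/[Q] of the bad sets, of which there are at most 2^|V| at the start. Denominators
    are cleared to stay in the natural numbers. *)
Definition greedy_inv t e d Q k E :=
  [/\ symmetric E, irreflexive E,
      (forall f, ~ @clique (rel_graph E) t.+1 f) & (forall x, deg E x <= d)%N] /\
  (\sum_x deg E x <= k * (t * t) /\
  #|bad_sets t e E| * Q ^ k <= 2 ^ #|V| * (Q - 1) ^ k)%N.

(* As the degree sum stays below Q n t^2, at most n / (2e) vertices have degree
   >= D; and b bounds the size of a ball of radius 2. *)
Lemma greedy_step t e k E (q := (4 * e)%N) (Q := (q ^ t)%N)
    (D := (2 * e * Q * (t * t))%N) (d := (D + t)%N) (b := (1 + d + d * d)%N) :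
    (0 < t)%N -> (0 < e)%N -> (0 < #|V|)%N -> (q * (t * b) <= #|V|)%N ->
    (k < Q * #|V|)%N ->
    greedy_inv t e d Q k E -> exists E', greedy_inv t e d Q k.+1 E'.
Proof.
move=> t0 e0 V0 Vbig kQ [[Es Ei free degd] [sumdeg bad]].
have Q0 : (0 < Q)%N by rewrite expn_gt0 /q muln_gt0 e0.
(* Without bad sets nothing has to be added: [E] itself satisfies the next invariant. *)
have [bad0|badN0] := posnP #|bad_sets t e E|.
  exists E; split; split=> //; last by rewrite bad0.
  by apply: leq_trans sumdeg _; rewrite leq_mul2r leqnSn orbT.
pose L := [set x | deg E x < D]%N.
have full_le : (2 * e * #|[set x | D <= deg E x]| <= #|V|)%N.
  have : (#|[set x | D <= deg E x]| * D <= Q * #|V| * (t * t))%N.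
    apply: card_full; apply: leq_trans sumdeg _; rewrite leq_mul2r.
    by apply/orP; right; exact: ltnW.
  rewrite /D => H.
  have : (2 * e * #|[set x | D <= deg E x]| * (Q * (t * t)) <=
          #|V| * (Q * (t * t)))%N.
    by move: H; rewrite -/D; set c := #|_|; rewrite /D; clearbody c Q; clear; nia.
  by rewrite leq_pmul2r // muln_gt0 Q0 muln_gt0 t0.
(* A bad set has at least |V|/e vertices, of which at most |V|/(2e) lie outside [L]; so [q] = 4e
   gives q |S :&: L| >= 2|V|, and half of this pays for the balls. *)
have large S : S \in bad_sets t e E -> (#|V| + q * (t * b) <= q * #|S :&: L|)%N.
  rewrite inE => /andP[Slarge _].
  have : (#|S| <= #|S :&: L| + #|[set x | D <= deg E x]|)%N.
    rewrite -(cardsID L S) leq_add2l; apply/subset_leq_card/fintype.subsetP => x.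
    by rewrite !inE -leqNgt => /andP[].
  rewrite /q in Vbig *; nia.
have [xs [sz xsL far popxs]] := popular_far_points V0 badN0 Es
  (fun x => card_near x degd) large.
exists (add_clique E xs); split; split.
- by move=> x y; rewrite /add_clique Es eq_sym [(y \in _) && _]andbC.
- by move=> x; rewrite /add_clique Ei eqxx.
- by move: free; rewrite -sz; apply: add_clique_free.
(* Only vertices of degree below [D] gain edges, at most [t] each, so no degree exceeds [d] = D +
   t. *)
- move=> x; apply: leq_trans (deg_add _ _ _) _; rewrite sz.
  case xxs: (x \in xs); last by rewrite addn0.
  by have := xsL _ xxs; rewrite inE /d mul1n leq_add2r => /ltnW.
- apply: leq_trans (sum_deg_add _ (far_uniq far)) _.
  by rewrite sz mulSn addnC leq_add2l.
- have := subset_leq_card (bad_sets_add e E (far_uniq far) sz).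
  rewrite cardsD.
  have -> : bad_sets t e E :&: [set S in bad_sets t e E | [set x in xs] \subset S] =
            [set S in bad_sets t e E | [set x in xs] \subset S].
    by apply/finset.setIidPr/fintype.subsetP => S; rewrite inE => /andP[].
  move: popxs; rewrite -/Q; set p := #|[set S in _ | _]|; set F := #|bad_sets t e E| in bad *.
  set F' := #|_| => popxs F'le.
  (* At least a fraction 1/[Q] of the bad sets includes [xs] and disappears. *)
  have F'Q : (F' * Q <= F * (Q - 1))%N.
    have : (F' * Q <= (F - p) * Q)%N by rewrite leq_mul2r F'le orbT.
    rewrite mulnBl mulnBr muln1; lia.
  rewrite !expnS; apply: (@leq_trans (F * (Q - 1) * Q ^ k)%N).
    by rewrite mulnA leq_mul2r F'Q orbT.
  rewrite mulnAC [(2 ^ _ * _)%N]mulnCA [X in (_ <= X)%N]mulnC leq_mul2r bad orbT //.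
Qed.

End Greedy.

(** Bernoulli's inequality for (Q/(Q-1))^k, with denominators cleared, at k = Q. Thus [Q] greedy
    steps more than halve the bound on the number of bad sets. *)
Lemma two_pred_exp_lt Q : (1 < Q)%N -> (2 * (Q - 1) ^ Q < Q ^ Q)%N.
Proof.
move=> Q1; have bern k : ((Q - 1) ^ k * (Q - 1 + k) <= Q ^ k * (Q - 1))%N.
  elim: k => [|k IH]; first by rewrite addn0.
  apply: (@leq_trans (Q * ((Q - 1) ^ k * (Q - 1 + k)))%N).
    rewrite expnS -mulnA mulnCA [X in (_ <= X)%N]mulnCA leq_mul2l; nia.
  by rewrite expnS -mulnA leq_mul2l IH orbT.
have := bern Q; have : (0 < (Q - 1) ^ Q)%N by rewrite expn_gt0; lia.
nia.
Qed.

(** After [Q * n] greedy steps from the edgeless graph, the bound 2^n (1 - 1/Q)^(Qn) on the number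
    of bad sets is below 1. *)
Lemma sparse_thick_graph t e : (0 < t)%N -> (0 < e)%N ->
  exists (n : nat) (E : rel 'I_n), [/\ (0 < n)%N, symmetric E, irreflexive E,
    (forall f, ~ @clique (rel_graph E) t.+1 f) &
    (forall S : {set 'I_n}, n <= e * #|S| -> thick t E S)%N].
Proof.
move=> t0 e0; pose q := (4 * e)%N; pose Q := (q ^ t)%N.
pose d := (2 * e * Q * (t * t) + t)%N; pose b := (1 + d + d * d)%N.
(* The constants above do not depend on [n], which is taken large enough for the size hypothesis of
   [greedy_step]. *)
pose n := (q * (t * b)).+1.
have Q1 : (1 < Q)%N by rewrite -{1}(exp1n t) ltn_exp2r // /q; lia.
have run k : (k <= Q * n)%N -> exists E : rel 'I_n, greedy_inv t e d Q k E.
  elim: k => [_|k IH kQ].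
    exists (fun _ _ => false); split; split=> //.
    - by move=> f /(_ ord0 (Ordinal (n := t.+1) (m := 1) t0)) /= H; suff: false by []; apply: H.
    - by move=> x; rewrite /deg (_ : [set _ | _] = finset.set0) ?cards0.
    - rewrite big1 // => x _; apply/eqP; rewrite cards_eq0.
      by apply/eqP/setP => y; rewrite !inE.
    - rewrite !expn0 !muln1 -cardsT -card_powerset; apply/subset_leq_card/fintype.subsetP => S _.
      by rewrite !inE.
  have [E invE] := IH (ltnW kQ).
  apply: (greedy_step t0 e0 _ _ _ invE); rewrite ?card_ord //.
have [E [[Es Ei free _] [_ bad]]] := run _ (leqnn _).
exists n, E; split=> // S nS; rewrite -[thick _ _ _]negbK; apply/negP => nthick.
have : (0 < #|bad_sets t e E|)%N.
  by apply/card_gt0P; exists S; rewrite inE card_ord nS nthick.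
move=> badN0; move: bad; rewrite card_ord !expnM -expnMn leqNgt => /negP[].
have lt : ((2 * (Q - 1) ^ Q) ^ n < (Q ^ Q) ^ n)%N by rewrite ltn_exp2r // two_pred_exp_lt.
apply: leq_trans lt _; exact: leq_pmull.
Qed.

(** * Generic graphs and quantifier elimination *)

Local Open Scope classical_set_scope.

Definition Kfree (k : nat) (G : structure) : Prop := forall f : 'I_k -> G, ~ clique f.

(** The extension axioms of the generic K_(t+1)-free graph; [N] is an arbitrary set, read through
    its trace on [B]. *)
Definition extension_property (t : nat) (G : structure) : Prop :=
  forall B N : set G, finite_set B ->
    (forall f : 'I_t -> G, (forall i, B (f i) /\ N (f i)) -> ~ clique f) ->
  exists w, forall b, B b -> w <> b /\ (edge w b <-> N b).

Definition generic_graph (t : nat) (G : structure) : Prop :=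
  [/\ is_graph G, Kfree t.+1 G & extension_property t G].

(** Equality of quantifier-free types on the variables in [X], the atomic formulas being equalities
    and edges. *)
Definition same_qf (G H : structure) (V : Type) (v : V -> G) (w : V -> H)
    (X : set V) : Prop :=
  forall x y, X x -> X y ->
    (v x = v y <-> w x = w y) /\ (edge (v x) (v y) <-> edge (w x) (w y)).

Definition with_new (V : Type) (X : set V) : set (option V) :=
  [set o | if o is Some x then X x else True].

Lemma same_qf_sym (G H : structure) (V : Type) (v : V -> G) (w : V -> H) X :
  same_qf v w X -> same_qf w v X.
Proof. by move=> vw x y Xx Xy; have [e1 e2] := vw x y Xx Xy; split; symmetry. Qed.

Lemma clique_cons (G : structure) k (f : 'I_k -> G) a :
  is_graph G -> clique f -> (forall i, edge a (f i)) ->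
  clique (fun i : 'I_k.+1 => oapp f a (unlift ord0 i)).
Proof.
move=> [_ Gs] cf af i j.
case: unliftP => [i' ->|->]; case: unliftP => [j' ->|->] //= ij; last exact: Gs.
by apply: cf => eq; apply: ij; rewrite eq.
Qed.

(** One step of back and forth. If [a] is an old value, the corresponding value is reused; otherwise
    the neighbourhood of [a] is transported to [H], where a t-clique in it would pull back to [G]
    and form a K_(t+1) together with [a]. *)
Lemma same_qf_extend t (G H : structure) (V : Type) (v : V -> G) (w : V -> H) X a :
  is_graph G -> Kfree t.+1 G -> is_graph H -> extension_property t H ->
  finite_set X -> same_qf v w X ->
  exists b, same_qf (oapp v a) (oapp w b) (with_new X).
Proof.
move=> Gg GK Hg Hext Xfin vw.
suff [b bP] : exists b, forall x, X x ->
    (a = v x <-> b = w x) /\ (edge a (v x) <-> edge b (w x)).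
  have [[Gi Gs] [Hi Hs]] := (Gg, Hg).
  exists b => -[x|] [y|] //= Xx Xy; last by split=> //; split=> [/Gi|/Hi].
  - exact: vw.
  - have [e1 e2] := bP _ Xx; split; first by split=> /esym/e1/esym.
    by split=> [/Gs/e2/Hs|/Hs/e2/Gs].
  - exact: bP.
have [[x0 [Xx0 ->]]|a_new] := pselect (exists x0, X x0 /\ a = v x0).
  by exists (w x0) => x Xx; apply: vw.
pose N := [set c | exists x, [/\ X x, w x = c & edge a (v x)]].
have [f fBN cf|b bP] := Hext (w @` X) N (finite_image _ Xfin).
  have /choice[x xP] : forall i, exists x, [/\ X x, w x = f i & edge a (v x)].
    by move=> i; have [_ [x xP]] := fBN i; exists x.
  apply: (GK _ (@clique_cons _ _ (v \o x) a _ _ _)) => // [i j ij|i] /=.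
    have [Xi wi _] := xP i; have [Xj wj _] := xP j.
    by apply/(vw _ _ Xi Xj).2; rewrite wi wj; apply: cf.
  by have [] := xP i.
exists b => x Xx; have [bx eN] : b <> w x /\ (edge b (w x) <-> N (w x)).
  by apply: bP; exists x.
split; first by split=> // ax; case: a_new; exists x.
split=> [ax|/eN[x' [Xx' wx' ax']]]; first by apply/eN; exists x.
by rewrite -((vw _ _ Xx' Xx).1.2 wx').
Qed.

Lemma finite_free_vars V (phi : formula V) : finite_set (free_vars phi).
Proof.
elim: phi => {V} [V x y|V x y|V|V phi1 IH1 phi2 IH2|V phi IH] /=.
- by rewrite finite_setU; split; apply: finite_set1.
- by rewrite finite_setU; split; apply: finite_set1.
- exact: finite_set0.
- by rewrite finite_setU.
- by apply: (finite_preimage (f := Some)) IH => x y _ _ [].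
Qed.

(** Back and forth: since a formula has finitely many free variables, [same_qf_extend] answers any
    choice for a quantified variable on either side. This is quantifier elimination, stated across
    two models so that it also yields elementarity of submodels. *)
Lemma sat_same_qf t (G H : structure) V (phi : formula V) (v : V -> G) (w : V -> H) :
  generic_graph t G -> generic_graph t H -> same_qf v w (free_vars phi) ->
  (sat v phi <-> sat w phi).
Proof.
move=> [Gg GK Gext] [Hg HK Hext].
elim: phi v w => {V} [V x y|V x y|V|V phi1 IH1 phi2 IH2|V phi IH] v w vw /=.
- by apply: (vw x y _ _).1 => /=; [left|right].
- by apply: (vw x y _ _).2 => /=; [left|right].
- by [].
- have e1 : sat v phi1 <-> sat w phi1 by apply: IH1 => x y ? ?; apply: vw; left.
  have e2 : sat v phi2 <-> sat w phi2 by apply: IH2 => x y ? ?; apply: vw; right.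
  by rewrite e1 e2.
- have fin := @finite_free_vars _ (All phi).
  have sub a b : same_qf (oapp v a) (oapp w b) (with_new (free_vars (All phi))) ->
      same_qf (oapp v a) (oapp w b) (free_vars phi).
    by move=> ab [x|] [y|] fx fy; apply: ab.
  split=> sat_all a.
    have [b ba] := @same_qf_extend t _ _ _ _ _ _ a Hg HK Gg Gext fin (same_qf_sym vw).
    exact/(IH _ _ (sub _ _ (same_qf_sym ba))).
  have [b ab] := @same_qf_extend t _ _ _ _ _ _ a Gg GK Hg Hext fin vw.
  exact/(IH _ _ (sub _ _ ab)).
Qed.

Lemma sat_rename (G : structure) V W (f : V -> W) (phi : formula V) (v : W -> G) :
  sat v (rename f phi) <-> sat (v \o f) phi.
Proof.
elim: phi W f v => {V} [V x y|V x y|V|V phi1 IH1 phi2 IH2|V phi IH] W f v //=.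
- by rewrite IH1 IH2.
- have e a : oapp v a \o omap f = oapp (v \o f) a by apply/funext => -[].
  by split=> H a; have := H a; rewrite IH e.
Qed.

Lemma free_vars_rename V W (f : V -> W) (phi : formula V) :
  free_vars (rename f phi) `<=` f @` free_vars phi.
Proof.
elim: phi W f => {V} [V x y|V x y|V|V phi1 IH1 phi2 IH2|V phi IH] W f //= z.
- by move=> [->|->]; [exists x|exists y] => //; [left|right].
- by move=> [->|->]; [exists x|exists y] => //; [left|right].
- by move=> [/(IH1 W f)[x]|/(IH2 W f)[x]] ? <-; exists x => //; [left|right].
- by move=> /(IH _ (omap f))[[x|] //= fx [<-]]; exists x.
Qed.

(** * Axiomatization and Fraisse limits *)

Lemma finite_set_range (T : Type) (B : set T) :
  finite_set B -> exists n (v : 'I_n -> T), range v = B.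
Proof.
move=> /(@finite_seqP {classic T})[l ->]; exists (size l), (tnth (in_tuple l)).
apply/seteqP; split=> [_ [i _ <-]|x /= /seq_tnthP[i ->]].
  exact: (mem_tnth i (in_tuple l)).
by exists i.
Qed.

Definition Top V : formula V := Imp Bot Bot.
Arguments Top {V}.

Definition And V (phi psi : formula V) : formula V := Not (Imp phi (Not psi)).

Definition Forall V (I : finType) (F : I -> formula V) : formula V :=
  foldr (fun i psi => And (F i) psi) Top (enum I).

(** Universal closure: [unlift ord0] sends variable 0 to [None], which [All] binds, and shifts the
    other variables down. *)
Fixpoint close n : formula 'I_n -> formula void :=
  if n is n'.+1 return formula 'I_n -> formula void
  then fun phi => close (All (rename (unlift ord0) phi))
  else rename (fun i : 'I_0 => False_rect void (not_false_is_true (valP i))).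

Section Sat.
Variables (G : structure).

Lemma sat_And V (v : V -> G) phi psi : sat v (And phi psi) <-> sat v phi /\ sat v psi.
Proof.
split=> [/= H|[p q] /= H]; last exact: H.
by split; apply: contrapT => n; apply: H => // p q; apply: n.
Qed.

Lemma sat_Forall V (v : V -> G) (I : finType) (F : I -> formula V) :
  sat v (Forall F) <-> forall i, sat v (F i).
Proof.
rewrite /Forall; suff -> : sat v (foldr (fun i psi => And (F i) psi) Top (enum I)) <->
    forall i, i \in enum I -> sat v (F i).
  by split=> H i; [apply: H; rewrite mem_enum|].
elim: (enum I) => [|i l IH]; first by split=> // _ [].
rewrite [foldr _ _ _]/= sat_And IH; split=> [[Fi Fl] j|H].
  by rewrite inE => /orP[/eqP->|/Fl].
by split=> [|j jl]; apply: H; rewrite inE ?eqxx ?jl ?orbT.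
Qed.

Lemma sat_close n (phi : formula 'I_n) :
  sat (of_void G) (close phi) <-> forall v : 'I_n -> G, sat v phi.
Proof.
elim: n phi => [|n IH] phi.
  have e (v w : 'I_0 -> G) : v = w by apply/funext => -[].
  rewrite [close _]/= sat_rename; split=> [H v|H]; last exact: H.
  have -> : v = of_void G \o (fun i : 'I_0 => False_rect void (not_false_is_true (valP i))) by [].
  exact: H.
rewrite [close _]/= IH; split=> H v /=.
  have : sat (oapp (v \o lift ord0) (v ord0)) (rename (unlift ord0) phi) := H _ _.
  rewrite sat_rename.
  suff -> : oapp (v \o lift ord0) (v ord0) \o unlift ord0 = v by [].
  by apply/funext => i /=; case: unliftP => [j|] ->.
by move=> a; rewrite sat_rename; apply: H.
Qed.

End Sat.

Definition Clique V k (f : 'I_k -> V) : formula V :=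
  Forall (fun p : 'I_k * 'I_k => if p.1 == p.2 then Top else Edge (f p.1) (f p.2)).

Lemma sat_Clique (G : structure) V (v : V -> G) k (f : 'I_k -> V) :
  sat v (Clique f) <-> clique (v \o f).
Proof.
rewrite sat_Forall; split=> [H i j ij|H [i j] /=].
  by have := H (i, j); rewrite /= (introF eqP ij).
by case: eqP => //= ij; apply: (H i j ij).
Qed.

Definition irreflexivity : formula 'I_1 := Not (Edge ord0 ord0).

Definition symmetry : formula 'I_2 := Imp (Edge ord0 ord_max) (Edge ord_max ord0).

Definition Kfreeness k : formula 'I_k := Not (Clique id).

(** Distinct variables may take equal values: the first premise says that the values indexed by [A]
    differ from the others, so that the prescribed adjacencies are consistent. The second excludes
    t-cliques among the values indexed by [A]. *)
Definition extension t n (A : {set 'I_n}) : formula 'I_n :=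
  Imp (Forall (fun p : 'I_n * 'I_n =>
         if (p.1 \in A) && (p.2 \notin A) then Not (Eq p.1 p.2) else Top))
  (Imp (Forall (fun f : {ffun 'I_t -> 'I_n} =>
          if [forall i, f i \in A] then Not (Clique f) else Top))
  (Not (All (Not (Forall (fun i : 'I_n =>
     And (Not (Eq None (Some i)))
         (if i \in A then Edge None (Some i) else Not (Edge None (Some i))))))))).

Lemma sat_extension (G : structure) t : extension_property t G <->
  forall n (A : {set 'I_n}) (v : 'I_n -> G), sat v (extension t A).
Proof.
split=> [ext n A v disj free none|sat_ext B N Bfin free].
  have disjoint i j : v i = v j -> i \in A -> j \in A.
    move=> vij iA; apply: contrapT => /negP jA.
    by have /sat_Forall/(_ (i, j)) := disj; rewrite /= iA jA; apply.
  have [||w wP] := ext (range v) [set v i | i in [set i | i \in A]].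
  - exact: finite_image.
  - move=> f fN cf.
    have /choice[h hP] : forall i, exists j, j \in A /\ v j = f i.
      by move=> i; have [_ [j jA <-]] := fN i; exists j.
    have /sat_Forall/(_ (finfun h)) := free.
    rewrite ifT; last by apply/forallP => i; rewrite ffunE; have [] := hP i.
    move=> H; apply: H; apply/sat_Clique => i j ij /=.
    by rewrite !ffunE (hP i).2 (hP j).2; apply: cf.
  apply: (none w); apply/sat_Forall => i; apply/sat_And.
  have [|wi eN] := wP (v i); first by exists i.
  split; first exact: wi.
  case: ifP => iA; first by apply/eN; exists i.
  by move=> /eN[j jA /disjoint/(_ jA)]; rewrite iA.
have [n [v vB]] := finite_set_range Bfin.
pose A := finset (fun i => `[< N (v i) >]).
have AP i : reflect (N (v i)) (i \in A) by rewrite inE; apply: asboolP.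
apply: contrapT => none; apply: (sat_ext n A v).
- apply/sat_Forall => -[i j] /=; case: ifP => //= /andP[/AP Ni /AP Nj] vij.
  by apply: Nj; rewrite -vij.
- apply/sat_Forall => f; case: ifP => //= /forallP fA /sat_Clique.
  by apply: free => i /=; split; [rewrite -vB; exists (f i)|apply/AP].
- move=> w /sat_Forall wP; apply: none; exists w => b; rewrite -vB => -[i _ <-].
  have /sat_And[wi wA] := wP i; split; first exact: wi.
  move: wA; case: (AP i) => Ni /= wA; first by split.
  by split=> [/wA|].
Qed.

Definition generic_axioms t : set (formula void) :=
  [set phi | [\/ phi = close irreflexivity, phi = close symmetry,
    phi = close (Kfreeness t.+1) |
    exists n (A : {set 'I_n}), phi = close (extension t A)]].

Lemma models_generic t (G : structure) :
  models G (generic_axioms t) <-> generic_graph t G.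
Proof.
split=> [mod|[[Gi Gs] GK Gext] phi].
  have [mi ms mK] : [/\ sat (of_void G) (close irreflexivity),
    sat (of_void G) (close symmetry) & sat (of_void G) (close (Kfreeness t.+1))].
    by split; apply: mod; [apply: Or41|apply: Or42|apply: Or43].
  split.
  - split=> [x|x y].
      by move/sat_close: mi => /(_ (fun _ => x)).
    move/sat_close: ms => /(_ (fun i => if i == ord0 then x else y)) /=.
    exact.
  - by move=> f cf; move/sat_close: mK => /(_ f); apply; apply/sat_Clique.
  - apply/sat_extension => n A; apply/sat_close; apply: mod.
    by apply: Or44; exists n, A.
by case=> [->|->|->|[n [A ->]]]; apply/sat_close => v;
  [exact: Gi|exact: Gs|move=> /sat_Clique; apply: GK|exact: ((sat_extension G t).1 Gext)].
Qed.

(* A one-point extension of the substructure B; the new vertex is [None]. *)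
Definition adjoin (G : structure) (B N : set G) : structure :=
  @Structure (option B) (fun x y => match x, y with
    | Some x, Some y => edge (val x) (val y)
    | None, Some x | Some x, None => N (val x)
    | None, None => False end).

Lemma finite_substructure (G : structure) (B : set G) :
  finite_set B -> finite_set [set: substructure B].
Proof.
move=> Bfin; apply: card_le_finite Bfin.
by have := card_setT B; rewrite card_eq_le => /andP[].
Qed.

Lemma finite_adjoin (G : structure) (B N : set G) :
  finite_set B -> finite_set [set: adjoin B N].
Proof.
move=> /finite_substructure Bfin.
have -> : [set: adjoin B N] = None |` (Some @` [set: substructure B]).
  by apply/seteqP; split=> // -[x|] _; [right; exists x|left].
by rewrite finite_setU; split; [apply: finite_set1|apply: finite_image].
Qed.

Lemma substructure_embeds (G : structure) (B : set G) : embeds (substructure B) G.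
Proof. by exists val; split=> //; apply: val_inj. Qed.

Lemma clique_embeds (G : structure) k (f : 'I_k -> G) :
  is_graph G -> clique f -> embeds (complete_graph k) G.
Proof.
move=> [Gi _] cf; exists f; split=> [i j fij|i j].
  by apply: contrapT => /cf; rewrite fij; apply: Gi.
by split=> [/cf//|e ij]; apply: (Gi (f i)); rewrite {2}ij.
Qed.

Lemma embeds_clique (G : structure) k : embeds (complete_graph k) G ->
  exists f : 'I_k -> G, clique f.
Proof. by move=> [f [_ fe]]; exists f => i j ij; apply/(fe i j). Qed.

Lemma embeds_finite_graph k (A : structure) :
  is_graph A -> Kfree k A -> finite_set [set: A] -> finite_Ks_free_graph k A.
Proof. by move=> Ag AK Afin; split=> // /embeds_clique[f]; apply: AK. Qed.

(** A (t+1)-clique meets the new vertex at most once; it lies in [G], or else removing the new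
    vertex leaves a t-clique inside [N]. *)
Lemma adjoin_Kfree t (G : structure) (B N : set G) :
  is_graph G -> Kfree t.+1 G ->
  (forall f : 'I_t -> G, (forall i, B (f i) /\ N (f i)) -> ~ clique f) ->
  Kfree t.+1 (adjoin B N).
Proof.
move=> Gg GK free f cf.
have noNone i x : f i = None -> f x = None -> i = x.
  by move=> fi fx; apply: contrapT => /cf; rewrite fi fx.
have [[i0 fi0]|allSome] := pselect (exists i, f i = None); last first.
  have /choice[g gP] : forall i, exists x, f i = Some x.
    by move=> i; case fi: (f i) => [x|]; [exists x|case: allSome; exists i].
  apply: (GK (fun i => val (g i))) => i j /cf; by rewrite !gP.
have /choice[g gP] : forall j, exists x, f (lift i0 j) = Some x.
  move=> j; case fj: (f _) => [x|]; first by exists x.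
  by have /eqP := noNone _ _ fi0 fj; rewrite (negbTE (neq_lift _ _)).
apply: (free (fun j => val (g j))) => [j|j k jk].
  split; first exact: set_valP.
  by have := cf i0 (lift i0 j); rewrite fi0 gP; apply; apply/eqP/neq_lift.
have := cf (lift i0 j) (lift i0 k); rewrite !gP; apply.
by move/lift_inj.
Qed.

(** The universal axioms are read off finite substructures. For the extension property, [adjoin B N]
    embeds into [G], and an automorphism given by ultrahomogeneity carries the embedded copy of [B]
    back to [B], taking the new vertex to the required [w]. *)
Lemma fraisse_limit_generic t (G : structure) :
  fraisse_limit (finite_Ks_free_graph t.+1) G -> generic_graph t G.
Proof.
move=> [_ homog age].
have subC (B : set G) : finite_set B -> finite_Ks_free_graph t.+1 (substructure B).
  by move=> /finite_substructure Bfin; apply/age => //; apply: substructure_embeds.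
have Gg : is_graph G.
  split=> [x|x y xy].
    have [_ [irr _] _] := subC [set x] (finite_set1 x).
    by have := irr (exist _ x (mem_set (erefl x))).
  have [|_ [_ sym] _] := subC [set x; y]; first by rewrite finite_setU; split; apply: finite_set1.
  have Bx : x \in [set x; y] by apply/mem_set; left.
  have By : y \in [set x; y] by apply/mem_set; right.
  exact: (sym (exist _ x Bx) (exist _ y By)).
have GK : Kfree t.+1 G.
  move=> f /(clique_embeds Gg) emb.
  have Kfin : finite_set [set: complete_graph t.+1] by apply: (@finite_finset 'I_t.+1).
  have [_ _ []] := (age _ Kfin).2 emb.
  by exists id; split.
split=> // B N Bfin free.
have Sfin := @finite_adjoin _ _ N Bfin.
have /(age (adjoin B N) Sfin).1[f [f_inj fe]] : finite_Ks_free_graph t.+1 (adjoin B N).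
  apply: embeds_finite_graph Sfin; last exact: adjoin_Kfree.
  by have [Gi Gs] := Gg; split=> [[x|]|[x|] [y|]] //=; exact: Gs.
have [|g [[g_bij ge] gf]] := homog B (f \o Some) Bfin.
  by split=> [x y /f_inj[]|x y] //; rewrite -fe.
have [g' g'K gK] := g_bij.
exists (g' (f None)) => b Bb; pose b' : B := exist _ b (mem_set Bb).
have gb : g b = f (Some b') := gf b'.
split=> [wb|]; first by have := gK (f None); rewrite wb gb => /f_inj.
by rewrite ge gK gb -(fe None).
Qed.

(** The axioms hold in every Fraisse limit, hence belong to [T2], the common theory of these
    limits. *)
Lemma models_T2_generic t (U : structure) : models U (T2 t.+1) -> generic_graph t U.
Proof.
move=> mod; apply/models_generic => phi ax; apply: mod => G /fraisse_limit_generic.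
by move=> /models_generic; apply.
Qed.

(** * Complete types *)

Definition generic_over (U : structure) (N C : set U) (a : U) : Prop :=
  forall b, C b -> a <> b /\ (edge a b <-> N b).

Definition params (U : Type) (phi : formula (option U)) : set U :=
  [set b | free_vars phi (Some b)].

(** Each formula has its own witness, generic over its finitely many parameters only; a vertex
    generic over all of [A] need not exist in [U]. By [holds_generic] the choice of witness is
    immaterial. *)
Definition type_of (U : structure) (N A : set U) : set (formula (option U)) :=
  [set phi | formulas_over A phi /\ exists2 a, generic_over N (params phi) a & holds phi a].

Lemma finite_params U (phi : formula (option U)) : finite_set (params phi).
Proof. by apply: finite_preimage (finite_free_vars phi) => x y _ _ []. Qed.

Section Types.
Variables (t : nat) (U : structure).
Hypothesis Ugen : generic_graph t U.
Implicit Types (N A C : set U) (a b : U) (phi : formula (option U)).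

Lemma holds_generic N phi a b :
  generic_over N (params phi) a -> generic_over N (params phi) b ->
  holds phi a -> holds phi b.
Proof.
move=> ga gb; apply: (sat_same_qf Ugen Ugen _).1.
have [[Ui Us] _ _] := Ugen.
move=> [x|] [y|] //= fx fy.
- have [ax eax] := ga _ fx; have [bx ebx] := gb _ fx.
  split; first by split=> /esym.
  split=> /Us; first by move/eax/ebx/Us.
  by move/ebx/eax/Us.
- have [ay eay] := ga _ fy; have [by_ eby] := gb _ fy.
  by split; [split|rewrite eay eby].
- by split=> //; split=> /Ui.
Qed.

Definition K_avoiding N : Prop :=
  forall f : 'I_t -> U, (forall i, N (f i)) -> ~ clique f.

Lemma exists_generic N C : K_avoiding N -> finite_set C -> exists a, generic_over N C a.
Proof.
by move=> NK Cfin; have [_ _ ext] := Ugen; apply: ext => // f fN; apply: NK => i; have [] := fN i.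
Qed.

Lemma type_of_holds N A phi a : type_of N A phi -> generic_over N (params phi) a ->
  holds phi a.
Proof. by move=> [_ [b gb bphi]] ga; apply: holds_generic gb ga bphi. Qed.

Lemma generic_realizes N A a : generic_over N A a -> realizes a (type_of N A).
Proof.
by move=> ga phi tphi; apply: (type_of_holds tphi) => b /tphi.1; apply: ga.
Qed.

(** It suffices to test the type on equality and edge formulas with a single parameter [b], whose
    membership is witnessed by a vertex [c] generic over [b]. *)
Lemma realizes_generic N A a : K_avoiding N -> realizes a (type_of N A) -> generic_over N A a.
Proof.
move=> NK real b Ab.
have [c cP] := exists_generic NK (finite_set1 b).
have {cP} [cb ecb] := cP b (erefl b).
have par (phi : formula (option U)) : params phi `<=` [set b] -> holds phi c -> holds phi a.
  move=> phib phic; apply: real; split; first by move=> d /phib ->.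
  by exists c => // d /phib ->.
split.
  by move=> ab; apply: (par (Not (Eq None (Some b))) _ cb) => // d [[|[->]]|].
have [Nb|nNb] := pselect (N b).
  split=> // _; apply: (par (Edge None (Some b)) _ (ecb.2 Nb)) => d [|[->]] //.
split=> // eab; exfalso; apply: (par (Not (Edge None (Some b))) _ _ eab).
  by move=> d [[|[->]]|].
by move=> /ecb.
Qed.

(** A vertex generic over the finitely many parameters involved realizes a given finite part of the
    type, or decides a given formula. *)
Lemma type_of_complete N A : K_avoiding N -> complete_type A (type_of N A).
Proof.
move=> NK; split=> [phi []//|F Ffin Fsub|phi Aphi].
  have Pfin : finite_set (\bigcup_(phi in F) params phi).
    by apply: bigcup_finite => // phi _; apply: finite_params.
  have [a ga] := exists_generic NK Pfin; exists a => phi Fphi.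
  by apply: (type_of_holds (Fsub _ Fphi)) => b phib; apply: ga; exists phi.
have [a ga] := exists_generic NK (finite_params phi).
have [h|h] := pselect (holds phi a); [left|right].
  by split=> //; exists a.
have par : params (Not phi) = params phi by apply/seteqP; split=> b; [case|left].
by split=> [b [/Aphi|]|] //; exists a => //; rewrite par.
Qed.

End Types.

Definition nonedge_type (U : structure) : set (formula (option U)) := type_of set0 setT.

Lemma nonedge_type_over (U : structure) (A : set U) phi :
  nonedge_type phi -> formulas_over A phi -> type_of set0 A phi.
Proof. by move=> [_ phia] Aphi; split. Qed.

Lemma set0_avoiding t (U : structure) : (0 < t)%N -> @K_avoiding t U set0.
Proof. by move=> t0 f /(_ (Ordinal t0)). Qed.

(** A type [q] containing all non-edges also contains every [x <> b]. Finite satisfiability then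
    realizes each formula of [q] by a vertex generic over its parameters, so [q] is included in
    [nonedge_type]; completeness of [q] gives equality. *)
Lemma nonedge_type_unique t (U : structure) : (1 < t)%N -> generic_graph t U ->
  unique (fun p => global_type p /\ contains_all_nonedges p) (@nonedge_type U).
Proof.
move=> t1 Ugen; have av := @set0_avoiding t U (ltnW t1).
have over (phi : formula (option U)) : formulas_over setT phi by [].
split; first split; first exact: (type_of_complete Ugen).
  move=> b; split=> //.
  have [a ga] := exists_generic Ugen av (finite_set1 b).
  exists a; first by move=> c [[|[->]]|] //; apply: ga.
  by have [_ [+ _]] := ga b (erefl b).
move=> q [[_ qfin qall] qE].
have qneq b : q (Not (Eq None (Some b))).
  have [qeq|//] := qall (Eq None (Some b)) (over _).
  (* As t >= 2, the set {b} is K_t-free, so [b] has a neighbour [d]; then [x = b] contradicts the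
     non-edge between [x] and [d]. *)
  have [d dP] : exists d, edge b d.
    have [||d dP] := @exists_generic t U Ugen [set b] [set b].
    - move=> f fb /(_ (Ordinal (ltnW t1)) (Ordinal t1)).
      rewrite /= !fb => bb; have [[Ui _] _ _] := Ugen.
      by apply: (Ui b); apply: bb.
    - exact: finite_set1.
    have [[_ Us] _ _] := Ugen; exists d; apply: Us.
    by have [_ ->] := dP b (erefl b).
  have [||e eP] := qfin [set Eq None (Some b); Not (Edge None (Some d))].
  - by rewrite finite_setU; split; apply: finite_set1.
  - by move=> psi [->|->]; [exact: qeq|exact: qE].
  have eb : e = b by apply: (eP (Eq None (Some b))); left.
  by case: (eP (Not (Edge None (Some d)))); [right|rewrite /= eb].
have key phi : q phi -> nonedge_type phi.
  move=> qphi; split=> //.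
  pose F := phi |` ((fun b => Not (Eq None (Some b))) @` params phi `|`
                    (fun b => Not (Edge None (Some b))) @` params phi).
  have [||a aP] := qfin F.
  - by rewrite !finite_setU; do !split; rewrite ?finite_set1 //; apply/finite_image/finite_params.
  - by move=> psi [->|[[b _ <-]|[b _ <-]]]; [exact: qphi|exact: qneq|exact: qE].
  exists a; last by apply: aP; left.
  move=> b phib; split.
    by apply: (aP (Not (Eq None (Some b)))); right; left; exists b.
  by split=> //; apply: (aP (Not (Edge None (Some b)))); right; right; exists b.
apply/seteqP; split=> phi; last exact: key.
move=> nphi.
have [//|/key nnphi] := qall phi (over _).
have [a ga] := exists_generic Ugen av (finite_params phi).
have /(type_of_holds Ugen nnphi) : generic_over set0 (params (Not phi)) a.
  by move=> b [/ga|].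
by case; apply: (type_of_holds Ugen nphi).
Qed.

(** * Small sets *)

Lemma countable_setU T (A B : set T) : countable A -> countable B -> countable (A `|` B).
Proof.
by move=> Ac Bc; rewrite -bigcup2E; apply: bigcup_countable => // -[|[|i]] _ /=.
Qed.

(** An infinite [A] includes a countably infinite [C], which maps onto the union of [C] and [B]; the
    remaining points of [A] stay fixed. *)
Lemma card_setU_le T (A B : set T) : infinite_set A -> countable B -> (A `|` B #<= A)%card.
Proof.
elim/Ppointed: T => T in A B *; first by rewrite emptyE => -[]; apply: finite_set0.
move=> /infiniteP/card_subP[C CN CA] Bc.
have /pcard_surjP[h hC] : (C `|` B #<= C)%card.
  rewrite (card_le_eqr CN); apply: countable_setU => //.
  by rewrite (eq_countable CN).
have /Psurj[g _] : set_surj A (A `|` B) (fun x => if `[< C x >] then h x else x).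
  move=> x ABx; have [CBx|nCBx] := pselect ((C `|` B) x).
    have [y Cy <-] := hC x CBx; exists y; first exact: CA.
    by rewrite asboolT.
  exists x; first by case: ABx => // Bx; case: nCBx; right.
  by rewrite asboolF // => Cx; apply: nCBx; left.
exact: surj_card_ge g.
Qed.

Lemma small_countable (K T : Type) (A : set T) :
  ~ countable [set: K] -> countable A -> small K A.
Proof. by move=> Kunc Ac KA; apply: Kunc; apply: sub_countable KA Ac. Qed.

Lemma small_setU (K T : Type) (A B : set T) :
  ~ countable [set: K] -> small K A -> countable B -> small K (A `|` B).
Proof.
move=> Kunc Asmall Bc; have [Afin|Ainf] := pselect (finite_set A).
  apply: small_countable => //; apply: countable_setU => //.
  exact: finite_set_countable.
move=> KAB; apply: Asmall; apply: card_le_trans KAB _; exact: card_setU_le.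
Qed.

Lemma finite_In (T : Type) (l : seq T) : finite_set [set x | List.In x l].
Proof.
elim: l => [|x l IH] /=; first by apply: sub_finite_set (finite_set0 T) => x [].
have -> : [set y | x = y \/ List.In y l] = x |` [set y | List.In y l].
  by apply/seteqP; split=> y [->|?]; by [left|right].
by rewrite finite_setU; split=> //; apply: finite_set1.
Qed.

(** * Failure of generic stability *)

Lemma morley_exists (K : Type) t (U : structure) (M : set U) :
  (0 < t)%N -> generic_graph t U -> ~ countable [set: K] -> saturated K U -> small K M ->
  exists a : nat -> U,
    morley_sequence M (@nonedge_type U) (fun i j => (i < j)%N) a /\
    forall i j, (j < i)%N -> a i <> a j /\ ~ edge (a i) (a j).
Proof.
move=> t0 Ugen Kunc Usat Msmall; have av := @set0_avoiding t U t0.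
have /choice[f fP] : forall l : seq U,
    exists a, generic_over set0 (M `|` [set x | List.In x l]) a.
  move=> l; have [|a ra] := Usat (M `|` [set x | List.In x l]) _ _ (type_of_complete Ugen _ av).
    by apply: small_setU => //; apply/finite_set_countable/finite_In.
  by exists a; exact: (realizes_generic Ugen av ra).
(* [h i] lists the terms of index below [i], so [f (h i)] is generic over [M] and all of them. *)
pose h i := iter i (fun l => f l :: l) [::].
have hP i j : (j < i)%N -> List.In (f (h j)) (h i).
  by elim: i => // i IH; rewrite ltnS leq_eqVlt => /orP[/eqP->|/IH]; [left|right].
exists (fun i => f (h i)); split=> [i phi [tphi Aphi]|i j ji].
  apply: (generic_realizes Ugen _ (nonedge_type_over tphi Aphi)) => b Ab.
  by apply: fP; case: Ab => [|[j ji <-]]; [left|right; apply: hP].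
have [ne [nE _]] := fP (h i) (f (h j)) (or_intror (hP _ _ ji)).
by split.
Qed.

Lemma infinite_parity (c : bool) : infinite_set [set i | odd i = c].
Proof.
move=> /(@finite_preimage _ _ _ (fun i => i.*2 + c)%N) fin; apply: infinite_nat.
have {}fin := fin (fun x y _ _ (e : (x.*2 + c = y.*2 + c)%N) => ltac:(lia)).
by apply: sub_finite_set fin => i _ /=; rewrite oddD odd_double; case: c.
Qed.

Lemma strict_well_order_nat : strict_well_order (fun i j : nat => (i < j)%N).
Proof.
split=> [|i j k|i j]; last 1 first.
- by case: (ltngtP i j) => [?|?|->]; [apply: Or31|apply: Or33|apply: Or32].
- by move=> i; elim/ltn_ind: i => i IH; constructor.
- exact: ltn_trans.
Qed.

Lemma nonedge_type_not_stable (K : Type) t (U : structure) :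
  (1 < t)%N -> generic_graph t U -> ~ countable [set: K] -> saturated K U ->
  ~ generically_stable K (@nonedge_type U).
Proof.
move=> t1 Ugen Kunc Usat [M [[Msmall _] _ stable]].
have [a [morley indep]] := morley_exists (ltnW t1) Ugen Kunc Usat Msmall.
have [_ _ avg] := stable _ _ a strict_well_order_nat infinite_nat morley.
have [[Ui Us] _ _] := Ugen.
have a_inj i j : a i = a j -> i = j.
  move=> aij; case: (ltngtP i j) => // [/indep|/indep] []; by rewrite aij.
have a_indep i j : ~ edge (a i) (a j).
  case: (ltngtP i j) => [ij /Us|ij|->]; last exact: Ui.
    by have [] := indep _ _ ij.
  by have [] := indep _ _ ij.
pose N := [set a i | i in [set i | odd i = false]].
have Nav : @K_avoiding t U N.
  move=> f fN /(_ (Ordinal (ltnW t1)) (Ordinal t1)).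
  have [i _ <-] := fN (Ordinal (ltnW t1)); have [j _ <-] := fN (Ordinal t1).
  by move=> H; apply: (@a_indep i j); apply: H.
(* An independent set is K_t-free for t >= 2, so saturation over the countable set [range a]
   provides a [b] whose neighbours in it are exactly the terms of even index. *)
have [|b /(realizes_generic Ugen Nav) bP] := Usat (range a) _ _ (type_of_complete Ugen _ Nav).
  by apply: small_countable => //; apply: sub_countable (card_image_le _ _) _.
have eb i : edge (a i) b <-> odd i = false.
  have [|_ eN] := bP (a i); first by exists i.
  split=> [/Us/eN[j jodd /a_inj <-] //|iodd].
  by apply/Us/eN; exists i.
have [//|fin|fin] := avg (Edge None (Some b)).
  apply: (@infinite_parity true); apply: sub_finite_set fin => i /= io.
  by move=> /eb; rewrite io.
apply: (@infinite_parity false); apply: sub_finite_set fin => i /= io.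
by apply; apply/eb.
Qed.

(** * Finite approximation *)

Lemma finite_sub_bigcup (T : Type) (M : nat -> set T) (B : set T) :
  (forall i j, (i <= j)%N -> M i `<=` M j) -> finite_set B ->
  B `<=` \bigcup_k M k -> exists k, B `<=` M k.
Proof.
move=> mono /finite_set_range[n [v <-]] sub.
have /choice[h hP] : forall i, exists k, M k (v i).
  by move=> i; have [|k _ Mk] := sub (v i); [exists i|exists k].
exists (\max_i h i)%N => _ [i _ <-]; apply: mono (hP i); exact: leq_bigmax.
Qed.

(** A Skolem hull: witnesses for all pairs of finite subsets are added, countably many at a time,
    and the process is iterated over the natural numbers. *)
Lemma countable_generic_submodel t (U : structure) : generic_graph t U -> (0 < t)%N ->
  exists M : set U, countable M /\ generic_graph t (substructure M).
Proof.
move=> Ugen t0; have [[Ui Us] UK Uext] := Ugen.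
have [u0 _] := exists_generic Ugen (@set0_avoiding t U t0) (finite_set0 U).
(* The witness function is total; [u0] is its default value where no witness exists. *)
have /choice[wit witP] : forall p : set U * set U, exists w, finite_set p.1 ->
    (forall f : 'I_t -> U, (forall i, p.1 (f i) /\ p.2 (f i)) -> ~ clique f) ->
    forall b, p.1 b -> w <> b /\ (edge w b <-> p.2 b).
  move=> [B N] /=.
  have [[w wP]|none] := pselect (exists w, forall b, B b -> w <> b /\ (edge w b <-> N b)).
    by exists w.
  by exists u0 => Bfin /(Uext _ _ Bfin)/none.
pose fin (A : set U) := [set B | B `<=` A /\ finite_set B].
pose step (A : set U) := A `|` wit @` (fin A `*` fin A).
pose M k := iter k step set0.
have Mc k : countable (M k).
  elim: k => [|k IH]; first exact: countable0.
  apply: countable_setU => //; apply: sub_countable (card_image_le _ _) _.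
  by apply: countableX; apply: countable_finite_subset.
have mono i j : (i <= j)%N -> M i `<=` M j.
  move=> /subnK <-; elim: (j - i)%N => //= k IH x /IH; by left.
exists (\bigcup_k M k); split; first exact: bigcup_countable.
split.
- by split=> [x|x y]; [apply: Ui|apply: Us].
- by move=> f cf; apply: (UK (val \o f)) => i j /cf.
move=> B N Bfin free.
have [|k Bk] := finite_sub_bigcup mono (finite_image val Bfin).
  by move=> _ [x _ <-]; apply: set_valP.
(* Intersecting with [B] makes the second component finite, so that this pair is among those treated
   by [step]. *)
pose B' := val @` B; pose N' := val @` (B `&` N).
have B'fin : finite_set B' by apply: finite_image.
have N'B : N' `<=` B' by move=> _ [x [Bx _] <-]; exists x.
have free' f : (forall i : 'I_t, B' (f i) /\ N' (f i)) -> ~ clique f.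
  move=> fN; have /choice[g gP] : forall i, exists x, (B `&` N) x /\ val x = f i.
    by move=> i; have [_ [x xBN xi]] := fN i; exists x.
  move=> cf; apply: (free g) => [i|i j /cf]; first exact: (gP i).1.
  by rewrite -(gP i).2 -(gP j).2.
have wP := witP (B', N') B'fin free'.
have Mw : (\bigcup_k M k) (wit (B', N')).
  exists k.+1 => //; right; exists (B', N') => //=.
  by split; split=> //; [apply: subset_trans Bk|apply: sub_finite_set N'B _].
pose w : substructure (\bigcup_k M k) := exist (fun x => x \in _) _ (mem_set Mw).
exists w => b Bb.
have [wb eN] := wP (val b) (ex_intro2 _ _ b Bb erefl).
split; first by move=> /(congr1 val).
rewrite /= eN; split=> [[c [_ Nc] /val_inj <-]|Nb] //; by exists b.
Qed.

Lemma generic_elementary t (U : structure) (M : set U) :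
  generic_graph t U -> generic_graph t (substructure M) -> elementary M.
Proof.
move=> Ugen Mgen n phi v; apply: (sat_same_qf Mgen Ugen) => x y _ _; split=> //.
by split=> [->|/val_inj].
Qed.

(** Vertices are placed one at a time with [same_qf_extend], the finite graph being the source and
    [H] providing the extension property. *)
Lemma embed_finite_graph t n (E : rel 'I_n) (H : structure) :
  symmetric E -> irreflexive E -> Kfree t.+1 (rel_graph E) -> (0 < t)%N ->
  generic_graph t H ->
  exists f : 'I_n -> H, injective f /\ forall i j, E i j <-> edge (f i) (f j).
Proof.
move=> Es Ei EK t0 Hgen; have [Hg _ Hext] := Hgen.
have Eg : is_graph (rel_graph E) by split=> [x|x y] /=; rewrite ?Ei // Es.
suff step k : exists f : 'I_n -> H,
    same_qf (id : 'I_n -> rel_graph E) f [set i | (i < k)%N].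
  have [f fP] := step n; exists f; split=> [i j|i j].
    exact: (fP i j (ltn_ord i) (ltn_ord j)).1.2.
  exact: (fP i j (ltn_ord i) (ltn_ord j)).2.
elim: k => [|k [f fP]].
  have [u0 _] := exists_generic Hgen (@set0_avoiding t H t0) (finite_set0 H).
  by exists (fun _ => u0).
have [nk|kn] := leqP n k.
  by exists f => i j _ _; apply: fP => /=; apply: leq_trans nk.
have kfin : finite_set [set i : 'I_n | (i < k)%N] by apply: finite_finset.
have [b bP] := same_qf_extend (Ordinal kn : rel_graph E) Eg EK Hg Hext kfin fP.
(* Vertex [k] plays the part of the new variable [None]. *)
pose o (i : 'I_n) := if i == k :> nat then None else Some i.
exists (oapp f b \o o) => i j /= ik jk.
have oE (x : 'I_n) : oapp id (Ordinal kn) (o x) = x.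
  by rewrite /o; case: eqP => //= xk; apply: val_inj.
have ok (x : 'I_n) : (x < k.+1)%N -> with_new [set i : 'I_n | (i < k)%N] (o x).
  by rewrite ltnS leq_eqVlt /o /with_new /=; case: eqP.
by have := bP _ _ (ok _ ik) (ok _ jk); rewrite !oE.
Qed.

(** The indices with image [u] contain no t-clique since there is at most one and t >= 2; those with
    image adjacent to [u] contain none since it would form a K_(t+1) with [u]. Each set thus has at
    most n/e elements. The vertex [u] may lie outside the image of [g]. *)
Lemma sparse_sample t e (H : structure) :
  (1 < t)%N -> (0 < e)%N -> generic_graph t H ->
  exists (n : nat) (a : 'I_n -> H), (0 < n)%N /\
    forall (U : structure) (g : H -> U), is_embedding g -> is_graph U -> Kfree t.+1 U ->
    forall u, (e * #|[pred i | `[< g (a i) = u \/ edge (g (a i)) u >]]| <= 2 * n)%N.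
Proof.
move=> t1 e0 Hgen; have t0 := ltnW t1.
have [n [E [n0 Es Ei EK thickE]]] := sparse_thick_graph t0 e0.
have [a [a_inj aE]] := embed_finite_graph Es Ei EK t0 Hgen.
exists n, a; split=> // U g [g_inj gE] Ug UK u.
pose X := finset (fun i => `[< g (a i) = u >]).
pose Y := finset (fun i => `[< edge (g (a i)) u >]).
have thin S : ~ thick t E S -> (e * #|S| <= n)%N.
  by move=> nthick; rewrite leqNgt; apply/negP => /ltnW/thickE.
have Xthin : (e * #|X| <= n)%N.
  apply: thin => /asboolP[f [fX /(_ (Ordinal t0) (Ordinal t1)) cf]].
  have /asboolP f0 : `[< g (a (f (Ordinal t0))) = u >] by have := fX (Ordinal t0); rewrite inE.
  have /asboolP f1 : `[< g (a (f (Ordinal t1))) = u >] by have := fX (Ordinal t1); rewrite inE.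
  have f01 : f (Ordinal t0) = f (Ordinal t1) by apply/a_inj/g_inj; rewrite f0 f1.
  by move: cf; rewrite /= f01 Ei => cf; suff: false by []; apply: cf.
have Ythin : (e * #|Y| <= n)%N.
  apply: thin => /asboolP[f [fY cf]].
  apply: (UK _ (@clique_cons _ _ (fun i => g (a (f i))) u Ug _ _)).
    by move=> i j /cf /aE /gE.
  by move=> i; apply: Ug.2; have := fY i; rewrite inE => /asboolP.
apply: (@leq_trans (e * (#|X| + #|Y|))%N); last by rewrite mulnDr mul2n -addnn leq_add.
rewrite leq_mul2l; apply/orP; right; apply: leq_trans (leq_card_setU X Y).
apply/subset_leq_card/fintype.subsetP => i; rewrite !inE => -[h|h].
  by apply/orP; left; apply/asboolP.
by apply/orP; right; apply/asboolP.
Qed.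

Lemma card_nongeneric m n e (U : structure) (a : 'I_n -> U) (b : 'I_m -> U) :
  (0 < e)%N ->
  (forall u, e * #|[pred i | `[< a i = u \/ edge (a i) u >]]| <= 2 * n)%N ->
  (e * #|finset (fun i => ~~ `[< generic_over set0 (range b) (a i) >])| <= m * (2 * n))%N.
Proof.
move=> e0 sparse; pose F j := finset (fun i => `[< a i = b j \/ edge (a i) (b j) >]).
have sub : finset (fun i => ~~ `[< generic_over set0 (range b) (a i) >]) \subset
    (\bigcup_(j in [set: 'I_m]) F j)%SET.
  apply/fintype.subsetP => i; rewrite inE => /asboolPn ngen.
  have [j jP] : exists j, a i = b j \/ edge (a i) (b j).
    apply: contrapT => none; apply: ngen => _ [j _ <-].
    by split=> [e1|]; [|split=> // e1]; apply: none; exists j; [left|right].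
  by apply/finset.bigcupP; exists j; rewrite ?inE //; apply/asboolP.
have bound : (#|(\bigcup_(j in [set: 'I_m]) F j)%SET| <= m * ((2 * n) %/ e))%N.
  have := @card_bigcup_le _ _ [set: 'I_m]%SET F ((2 * n) %/ e).
  rewrite finset.cardsT card_ord; apply=> j _.
  rewrite leq_divRL // mulnC; apply: leq_trans (sparse (b j)).
  by rewrite leq_mul2l cardsE leqnn orbT.
have le := leq_mul (leqnn e) (leq_trans (subset_leq_card sub) bound).
apply: leq_trans le _; rewrite mulnCA leq_mul2l mulnC leq_divM orbT //.
Qed.

Import Order.TTheory GRing.Theory Num.Theory.
Local Open Scope ring_scope.

(** The error is the proportion of indices where [h] fails if [P] is true, and where [h] holds if
    [P] is false; all of them lie in [B]. *)
Lemma dist_truth_frequency (R : realType) n (P : bool) (h : pred 'I_n) (B : {set 'I_n}) (eps : R) :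
  (0 < n)%N -> (forall i, i \notin B -> h i = P) -> #|B|%:R / n%:R < eps ->
  `| (nat_of_bool P)%:R - #|h|%:R / n%:R | < eps.
Proof.
move=> n0 hP; apply: le_lt_trans.
have nR : (n%:R : R) != 0 by rewrite pnatr_eq0 -lt0n.
have sub (h' : pred 'I_n) : (forall i, i \notin B -> ~~ h' i) -> (#|h'| <= #|B|)%N.
  move=> h'B; apply/subset_leq_card/fintype.subsetP => i h'i.
  by apply: contraLR h'i => /h'B.
case: P hP => hP.
  have -> : (nat_of_bool true)%:R = n%:R / n%:R :> R by rewrite divff.
  rewrite -mulrBl -natrB; last by rewrite -[X in (_ <= X)%N]card_ord max_card.
  rewrite ger0_norm ?divr_ge0 // ler_pM2r ?invr_gt0 ?ltr0n // ler_nat.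
  have -> : (n - #|h| = #|[predC h]|)%N by rewrite -[X in (X - _)%N]card_ord -(cardC h) addKn.
  by apply: (sub (fun i => ~~ h i)) => i /hP ->.
rewrite sub0r normrN ger0_norm ?divr_ge0 // ler_pM2r ?invr_gt0 ?ltr0n // ler_nat.
by apply: sub => i /hP ->.
Qed.

Lemma nonedge_type_finitely_approximated (R : realType) (K : Type) t (U : structure) :
  (1 < t)%N -> generic_graph t U -> ~ countable [set: K] ->
  finitely_approximated R K (@nonedge_type U).
Proof.
move=> t1 Ugen Kunc; have [Ug UK _] := Ugen.
have [M [Mc Mgen]] := countable_generic_submodel Ugen (ltnW t1).
exists M; split.
  by split; [apply: small_countable|apply: generic_elementary Ugen Mgen].
(* At most m(2n/e) sample points are not generic over [b], so e > 2m/eps makes their proportion less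
   than [eps]. *)
move=> m phi eps eps0; pose e := (Num.bound ((m * 2)%:R / eps)).+1.
have e_big : (m * 2)%:R / eps < e%:R.
  apply: lt_le_trans (archi_boundP _) _; first by rewrite divr_ge0 // ltW.
  by rewrite ler_nat.
have [n [a [n0 sparse]]] := sparse_sample t1 (ltn0Sn _ : (0 < e)%N) Mgen.
exists n, (fun i => val (a i)); split=> // [i|b]; first exact: set_valP.
have few := card_nongeneric b (ltn0Sn _ : (0 < e)%N)
  (sparse U val (conj val_inj (fun _ _ => iff_refl _)) Ug UK).
set B := finset _ in few.
apply: (dist_truth_frequency (B := B) n0 _ (le_lt_trans _ (_ : (m * 2)%:R / e%:R < eps))).
(* A sample point generic over [b] satisfies the instance exactly when the instance is in the type,
   because the parameters of the instance lie in the range of [b]. *)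
- move=> i; rewrite finset.in_set negbK => /asboolP gen; apply/asbool_equiv_eq.
  have gen' : generic_over set0 (params (inst phi b)) (val (a i)).
    move=> u uphi; have [[j|] // _ [bj]] := free_vars_rename uphi.
    by apply: gen; exists j.
  split=> [h|/(type_of_holds Ugen)]; last exact.
  by split=> //; exists (val (a i)).
- rewrite ler_pdivrMr ?ltr0n // mulrAC ler_pdivlMr ?ltr0n // -!natrM ler_nat.
  by rewrite -mulnA mulnC.
- by rewrite ltr_pdivrMr ?ltr0n // mulrC -ltr_pdivrMr.
Qed.

Theorem theorem5p8 (R : realType) (s : nat) (K : Type) (U : structure) :
  (3 <= s)%N -> monster_model K (T2 s) U ->
  exists pE : set (formula (option U)),
    [/\ unique (fun p => global_type p /\ contains_all_nonedges p) pE,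
        finitely_approximated R K pE &
        ~ generically_stable K pE].
Proof.
case: s => // t t1 [Kunc /models_T2_generic Ugen Usat _].
exists (@nonedge_type U); split.
- exact: nonedge_type_unique t1 Ugen.
- exact: nonedge_type_finitely_approximated t1 Ugen Kunc.
- exact: nonedge_type_not_stable t1 Ugen Kunc Usat.
Qed.
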